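(* Let $\ell$ be a prime power and let $r\subset PG(3,\ell^6)$ be a line. Then $$|r\cap \mathcal{GK}(\mathbb{F}_{\ell^6})|\le \ell^2-\ell+1.$$ Moreover, any $(\ell^2-\ell+1)$-secant of $\mathcal{GK}$ is parallel to the $z$-axis, and none of its $\ell^2-\ell+1$ common points with $\mathcal{GK}(\mathbb{F}_{\ell^6})$ is $\mathbb{F}_{\ell^2}$-rational.
   Context: $\ell=p^h$ with $p$ prime and $h\ge 1$. $PG(3,\ell^6)$ is the three-dimensional projective space over the field $\mathbb{F}_{\ell^6}$, with homogeneous coordinates $(X:Y:Z:T)$; affine points are those with $T=1$. The Giulietti-Korchmáros curve $\mathcal{GK}$ is the non-singular projective curve in $PG(3,\ell^6)$ with affine equations $$Z^{\ell^2-\ell+1}=Y^{\ell^2}-Y,\qquad Y^{\ell+1}=X^\ell+X,$$ having a unique point at infinity $P_\infty=(1:0:0:0)$. $\mathcal{GK}(\mathbb{F}_{\ell^6})$ denotes the set of its $\mathbb{F}_{\ell^6}$-rational points (including $P_\infty$), and $\mathcal{GK}(\mathbb{F}_{\ell^2})$ the set of its $\mathbb{F}_{\ell^2}$-rational points. A $k$-secant is a line of $PG(3,\ell^6)$ meeting $\mathcal{GK}(\mathbb{F}_{\ell^6})$ in exactly $k$ points. A line is parallel to the $z$-axis if it has affine equations $X=x_1$, $Y=y_1$ with $x_1,y_1\in\mathbb{F}_{\ell^6}$ constants.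
   Formalization: The ''Moreover'' part is stated only for ℓ ≠ 2: for ℓ = 2 it is false, since the line Y = T, Z = 0 is a 3-secant that is not parallel to the z-axis and whose three common points are all F_4-rational; the bound is kept for every ℓ. *)

(* Defs.v *)
From HB Require Import structures.
From mathcomp Require Import all_boot all_order all_algebra.

Set Implicit Arguments.
Unset Strict Implicit.
Unset Printing Implicit Defensive.

Import GRing.Theory.

Local Open Scope ring_scope.

(* PG(3,K): its points and lines are the subspaces of K^4 of (vector space)   *)
(* dimension 1 and 2 respectively.                                            *)
Record pg3_point (K : finFieldType) := PG3Point {
  pg3_point_space :> {vspace 'rV[K]_4};
  pg3_point_dim : \dim pg3_point_space == 1%N
}.

Record pg3_line (K : finFieldType) := PG3Line {
  pg3_line_space :> {vspace 'rV[K]_4};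
  pg3_line_dim : \dim pg3_line_space == 2%N
}.

HB.instance Definition _ (K : finFieldType) :=
  [isSub for @pg3_point_space K].

(* Finiteness is transported along the set of vectors of a point. *)
Definition pg3_point_vectors (K : finFieldType) (P : pg3_point K) :
  {set 'rV[K]_4} := [set v | v \in (P : {vspace _})].

Definition pg3_point_of_vectors (K : finFieldType) (A : {set 'rV[K]_4}) :
  option (pg3_point K) :=
  insub <<enum A>>%VS.

Lemma pg3_point_vectorsK (K : finFieldType) :
  pcancel (@pg3_point_vectors K) (@pg3_point_of_vectors K).
Proof.
move=> P; rewrite /pg3_point_of_vectors.
suff -> : <<enum (pg3_point_vectors P)>>%VS = val P by rewrite valK.
apply/eqP; rewrite eqEsubv; apply/andP; split.
  by apply/span_subvP => v; rewrite mem_enum inE.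
by apply/subvP => v Pv; apply: memv_span; rewrite mem_enum inE.
Qed.

HB.instance Definition _ (K : finFieldType) :=
  Finite.copy (pg3_point K) (pcan_type (@pg3_point_vectorsK K)).

Definition pg3_points_on (K : finFieldType) (r : pg3_line K) :
  {set pg3_point K} := [set P : pg3_point K | (P <= r)%VS].

Definition hcoord (K : finFieldType) (X Y Z T : K) : 'rV[K]_4 :=
  \row_(i < 4) [:: X; Y; Z; T]`_i.

(* P = (X : Y : Z : T); this is false when X, Y, Z, T all vanish, as P has    *)
(* dimension 1.                                                               *)
Definition has_coords (K : finFieldType) (P : pg3_point K) (X Y Z T : K) :
  bool := pg3_point_space P == <[hcoord X Y Z T]>%VS.

(* The K-rational points of the Giulietti-Korchmaros curve with parameter l;  *)
(* the curve lives in PG(3,K) for #|K| = l ^ 6.                               *)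
(* The point at infinity is adjoined by hand: homogenizing the two affine     *)
(* equations would add the whole line Y = T = 0.                              *)
Definition GK (l : nat) (K : finFieldType) : {set pg3_point K} :=
  [set P : pg3_point K |
     has_coords P 1 0 0 0 ||
     [exists x : K, [exists y : K, [exists z : K,
       [&& has_coords P x y z 1,
           z ^+ (l ^ 2 - l + 1) == y ^+ (l ^ 2) - y
         & y ^+ (l + 1) == x ^+ l + x]]]]].

(* The points with homogeneous coordinates in F_q, the subfield of q elements *)
(* of K being {a | a ^+ q = a}.                                               *)
Definition rational_over (q : nat) (K : finFieldType) (P : pg3_point K) : bool :=
  [exists v : 'rV[K]_4,
     (pg3_point_space P == <[v]>%VS) && [forall i, v 0 i ^+ q == v 0 i]].

Definition GK_rational (l q : nat) (K : finFieldType) : {set pg3_point K} :=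
  [set P in GK l K | rational_over q P].

Definition secant (l k : nat) (K : finFieldType) (r : pg3_line K) : Prop :=
  #|pg3_points_on r :&: GK l K| = k.

(* The affine points of r are those with X = x1 and Y = y1. *)
Definition parallel_to_z_axis (K : finFieldType) (r : pg3_line K) : Prop :=
  exists x1 y1 : K, forall x y z : K,
    (hcoord x y z 1 \in (r : {vspace _})) <-> x = x1 /\ y = y1.

(* Main.v *)
Require Import Defs.
From mathcomp Require Import all_boot all_order all_algebra.
From mathcomp Require Import ring zify.

(** Off the plane at infinity a line is [t |-> (x0 + t a, y0 + t b, z0 + t c)].
    If [a] or [b] is nonzero, substituting in [Y ^ (l + 1) = X ^ l + X] gives a
    nonzero polynomial in [t], of degree [l + 1] if [b <> 0] and [l] if [b = 0];
    as the point at infinity of the curve lies on the line only if [b = c = 0],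
    there are at most [l + 1] common points, and [l + 1 <= l ^ 2 - l + 1] with
    equality only for [l = 2].  If [a = b = 0], the common points are the roots
    of [Z ^ (l ^ 2 - l + 1) = y0 ^ (l ^ 2) - y0], which has the single root [0]
    when [y0 ^ (l ^ 2) = y0]. *)

Set Implicit Arguments.
Unset Strict Implicit.
Unset Printing Implicit Defensive.

Import GRing.Theory.

Local Open Scope ring_scope.

(** * Homogeneous coordinates, and parametrization of lines *)

Section HomogeneousCoordinates.

Variable K : finFieldType.
Implicit Types (x y z t a b c : K) (r : pg3_line K) (P : pg3_point K).

Lemma hcoord_inj x y z t x' y' z' t' :
  hcoord x y z t = hcoord x' y' z' t' -> [/\ x = x', y = y', z = z' & t = t'].
Proof.
move=> /rowP E.
by split; [have := E (@Ordinal 4 0 isT) | have := E (@Ordinal 4 1 isT)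
  | have := E (@Ordinal 4 2 isT) | have := E (@Ordinal 4 3 isT)]; rewrite !mxE.
Qed.

Lemma hcoord_surj (v : 'rV[K]_4) : exists x y z t, v = hcoord x y z t.
Proof.
exists (v 0 (@Ordinal 4 0 isT)), (v 0 (@Ordinal 4 1 isT)),
  (v 0 (@Ordinal 4 2 isT)), (v 0 (@Ordinal 4 3 isT)).
apply/rowP => -[[|[|[|[|//]]]] i_lt]; rewrite mxE /=;
  by congr (v _ _); apply: val_inj.
Qed.

Lemma hcoordD x y z t x' y' z' t' :
  hcoord x y z t + hcoord x' y' z' t' =
  hcoord (x + x') (y + y') (z + z') (t + t').
Proof. by apply/rowP => -[[|[|[|[|//]]]] i_lt]; rewrite !mxE. Qed.

Lemma hcoordZ k x y z t :
  k *: hcoord x y z t = hcoord (k * x) (k * y) (k * z) (k * t).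
Proof. by apply/rowP => -[[|[|[|[|//]]]] i_lt]; rewrite !mxE. Qed.

Lemma hcoord0 : hcoord 0 0 0 0 = 0 :> 'rV[K]_4.
Proof. by apply/rowP => -[[|[|[|[|//]]]] i_lt]; rewrite !mxE. Qed.

Lemma has_coords_mem r P x y z t :
  P \in pg3_points_on r -> has_coords P x y z t ->
  hcoord x y z t \in (r : {vspace _}).
Proof. by rewrite inE => /subvP rP /eqP P_E; apply: rP; rewrite P_E memv_line. Qed.

Lemma has_coords_uniq P Q x y z t :
  has_coords P x y z t -> has_coords Q x y z t -> P = Q.
Proof. by move=> /eqP P_E /eqP Q_E; apply: val_inj; rewrite /= P_E Q_E. Qed.

(** As [r] has dimension 2, a complement of [<[u]>] in [r] is a line of vectors; [w] is a generator
    of it. *)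
Lemma line_spanned r (u : 'rV[K]_4) :
  u \in (r : {vspace _}) -> u != 0 ->
  exists w, [/\ w \in (r : {vspace _}), w \notin <[u]>%VS
    & forall v, v \in (r : {vspace _}) -> exists k j, v = k *: w + j *: u].
Proof.
move=> ru u0; have ur : (<[u]> <= r)%VS by rewrite -memvE.
have dim_r := eqP (pg3_line_dim r).
have dimD : \dim (r :\: <[u]>)%VS = 1%N.
  have := dimv_cap_compl r <[u]>%VS.
  by rewrite (capv_idPr ur) dim_vline u0 dim_r => -[].
have vD := memv_pick (r :\: <[u]>)%VS.
have w0 : vpick (r :\: <[u]>)%VS != 0 by rewrite vpick0 -dimv_eq0 dimD.
have defD : (r :\: <[u]>)%VS = <[vpick (r :\: <[u]>)]>%VS.
  by apply/esym/eqP; rewrite eqEdim -memvE vD dim_vline w0 dimD.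
move: (vpick _) vD w0 defD => w vD w0 defD; exists w; split.
- exact: (subvP (diffvSl _ _)) vD.
- apply: contra w0 => wu; rewrite -memv0 -(capv_diff r <[u]>%VS).
  by rewrite memv_cap vD wu.
- move=> v rv; have : v \in (r :\: <[u]> + <[u]>)%VS.
    by rewrite addv_diff (addv_idPl ur).
  rewrite defD => /memv_addP [_ /vlineP[k ->] [_ /vlineP[j ->] ->]].
  by exists k, j.
Qed.

(** The direction [(a, b, c, 0)] spans [r] together with the given affine point. Comparing last
    coordinates, the coefficient of that point is 1 at an affine point and 0 at a point at infinity,
    so [P_infty] can only be the direction itself. *)
Lemma affine_line_param r x0 y0 z0 :
  hcoord x0 y0 z0 1 \in (r : {vspace _}) ->
  exists a b c, [/\ [|| a != 0, b != 0 | c != 0],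
    hcoord a b c 0 \in (r : {vspace _}),
    forall x y z, hcoord x y z 1 \in (r : {vspace _}) ->
      exists t, [/\ x = x0 + t * a, y = y0 + t * b & z = z0 + t * c]
    & hcoord 1 0 0 0 \in (r : {vspace _}) -> b = 0 /\ c = 0].
Proof.
move=> ru; have u0 : hcoord x0 y0 z0 1 != 0.
  rewrite -hcoord0; apply/eqP => /hcoord_inj[_ _ _ /eqP].
  by rewrite oner_eq0.
have [w [rw wu r_span]] := line_spanned ru u0.
have [x1 [y1 [z1 [s w_E]]]] := hcoord_surj w.
set u := hcoord x0 y0 z0 1 in ru u0 wu r_span.
(* Subtracting [s] times [u] kills the last coordinate. *)
have d_E : w - s *: u = hcoord (x1 - s * x0) (y1 - s * y0) (z1 - s * z0) 0.
  rewrite w_E -scaleNr hcoordZ hcoordD; congr hcoord; ring.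
have {r_span} r_span v : v \in (r : {vspace _}) ->
    exists k j, v = k *: hcoord (x1 - s * x0) (y1 - s * y0) (z1 - s * z0) 0
      + j *: u.
  move=> /r_span[k [j ->]]; exists k, (k * s + j).
  by rewrite -d_E scalerBr scalerDl scalerA addrA subrK.
have rd : w - s *: u \in (r : {vspace _}) by rewrite memvB // memvZ.
have d0 : w - s *: u != 0.
  by apply: contra wu; rewrite subr_eq0 => /eqP ->; rewrite memvZ // memv_line.
rewrite d_E in rd d0; move: rd d0 r_span.
move: (x1 - _) (y1 - _) (z1 - _) => a b c rd d0 r_span.
exists a, b, c; split => //.
- apply: contraR d0; rewrite !negb_or !negbK => /and3P[/eqP-> /eqP-> /eqP->].
  by rewrite hcoord0.
- move=> x y z /r_span[k [j]]; rewrite !hcoordZ hcoordD.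
  move=> /hcoord_inj[-> -> ->]; rewrite mulr0 add0r mulr1 => <-.
  by exists k; rewrite !mul1r; split; rewrite addrC.
- move=> /r_span[k [j]]; rewrite !hcoordZ hcoordD.
  move=> /hcoord_inj[k1 k2 k3]; rewrite mulr0 add0r mulr1 => j0.
  move: k1 k2 k3; rewrite -j0 !mul0r !addr0.
  have [->|k0 _] := eqVneq k 0.
    by rewrite mul0r => /eqP; rewrite oner_eq0.
  by move=> /esym/eqP; rewrite mulf_eq0 (negPf k0) => /eqP->
    /esym/eqP; rewrite mulf_eq0 (negPf k0) => /eqP->.
Qed.

(** A parameter determines its point through [f], so choosing one root for each point of [A] is
    injective, and [E] has fewer roots than its size. *)
Lemma card_param_lt_size (A : {set pg3_point K}) (f : K -> 'rV[K]_4)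
    (E : {poly K}) :
  E != 0 ->
  (forall P, P \in A ->
     exists2 t, pg3_point_space P == <[f t]>%VS & root E t) ->
  (#|A| < size E)%N.
Proof.
move=> E0 A_f.
(* The default 0 is never taken on [A]. *)
pose g P := odflt 0 [pick t | (pg3_point_space P == <[f t]>%VS) && root E t].
have gP P : P \in A -> pg3_point_space P = <[f (g P)]>%VS /\ root E (g P).
  move=> /A_f[t Pt Et]; rewrite /g; case: pickP => [s /andP[/eqP]//|].
  by move/(_ t); rewrite Pt Et.
have g_inj : {in A &, injective g}.
  move=> P Q /gP[P_E _] /gP[Q_E _] gPQ; apply: val_inj.
  by rewrite /= P_E Q_E gPQ.
rewrite -(card_in_imset g_inj) cardE; apply: max_poly_roots => //.
  by apply/allP => t; rewrite mem_enum => /imsetP[P /gP[_ Et] ->].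
exact: enum_uniq.
Qed.

End HomogeneousCoordinates.

(** * Restriction of the curve to a line *)

Section LinesAndCurve.

Variables (K : finFieldType) (l : nat).
Hypothesis l_gt1 : (1 < l)%N.
Implicit Types (x y z a b c : K) (r : pg3_line K) (P : pg3_point K).

Lemma mem_GK P :
  P \in GK l K -> has_coords P 1 0 0 0 \/
  exists x y z, [/\ has_coords P x y z 1,
    z ^+ (l ^ 2 - l + 1) = y ^+ (l ^ 2) - y & y ^+ (l + 1) = x ^+ l + x].
Proof.
rewrite inE => /orP[|/existsP[x /existsP[y /existsP[z]]]]; first by left.
by move=> /and3P[Pxyz /eqP zE /eqP yE]; right; exists x, y, z.
Qed.

Lemma rational_affine q P x y z :
  rational_over q P -> has_coords P x y z 1 -> y ^+ q = y.
Proof.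
move=> /existsP[v /andP[/eqP P_v /forallP v_q]] /eqP P_E.
have : hcoord x y z 1 \in <[v]>%VS by rewrite -P_v P_E memv_line.
move=> /vlineP[k]; have [x' [y' [z' [t v_E]]]] := hcoord_surj v.
have := v_q (@Ordinal 4 3 isT); have := v_q (@Ordinal 4 1 isT).
rewrite v_E !mxE /= hcoordZ => /eqP y'q /eqP tq /hcoord_inj[_ -> _ kt].
have : (k * t) ^+ q = 1 by rewrite -kt expr1n.
rewrite exprMn tq => kqt.
(* From [k * t = 1 = k ^+ q * t], cancelling [t] puts the scaling factor [k] in the fixed field
   too. *)
have t0 : t != 0.
  by apply/eqP => t0; move: kt => /eqP; rewrite t0 mulr0 oner_eq0.
by rewrite exprMn y'q; congr (_ * _); apply: (mulIf t0); rewrite kqt kt.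
Qed.

(** The Hermitian curve [Y ^ (l + 1) = X ^ l + X], the projection of the curve along the z-axis,
    pulled back to the parametrized line. *)
Definition restricted_hermitian (x0 a y0 b : K) : {poly K} :=
  (x0%:P + a *: 'X) ^+ l + (x0%:P + a *: 'X) - (y0%:P + b *: 'X) ^+ l.+1.

Lemma size_affine_poly x a : a != 0 -> size (x%:P + a *: 'X) = 2%N.
Proof.
move=> a0; rewrite addrC size_polyDl size_scale ?size_polyX //.
exact: leq_ltn_trans (size_polyC_leq1 _) _.
Qed.

Lemma size_affine_poly_leq x a : (size (x%:P + a *: 'X)%R <= 2)%N.
Proof.
have [->|/size_affine_poly-> //] := eqVneq a 0.
by rewrite scale0r addr0 (leq_trans (size_polyC_leq1 _)).
Qed.

Lemma size_affine_polyX_leq x a n : (size ((x%:P + a *: 'X) ^+ n)%R <= n.+1)%N.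
Proof.
apply: leq_trans (size_poly_exp_leq _ _) _.
by have := size_affine_poly_leq x a; nia.
Qed.

Lemma size_affine_polyX x a n :
  a != 0 -> size ((x%:P + a *: 'X) ^+ n) = n.+1.
Proof.
(* [size_exp] only gives the predecessor of the size, hence the need for a nonzero power. *)
move=> a0; have p0 : (x%:P + a *: 'X) ^+ n != 0.
  by rewrite expf_neq0 // -size_poly_eq0 size_affine_poly.
have := size_exp (x%:P + a *: 'X) n; rewrite size_affine_poly // mul1n.
by rewrite -size_poly_gt0 in p0; move=> E; rewrite -(prednK p0) E.
Qed.

Lemma size_restricted_hermitian x0 a y0 b :
  b != 0 -> size (restricted_hermitian x0 a y0 b) = l.+2.
Proof.
move=> b0; rewrite /restricted_hermitian addrC size_polyDl size_polyN.
  exact: size_affine_polyX.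
rewrite size_affine_polyX // ltnS (leq_trans (size_polyD _ _)) // geq_max.
by rewrite size_affine_polyX_leq (leq_trans (size_affine_poly_leq _ _)) // ltnW.
Qed.

Lemma size_restricted_hermitian0 x0 a y0 :
  a != 0 -> size (restricted_hermitian x0 a y0 0) = l.+1.
Proof.
move=> a0; rewrite /restricted_hermitian scale0r addr0 -addrA.
rewrite size_polyDl size_affine_polyX // ltnS.
rewrite (leq_trans (size_polyD _ _)) // geq_max size_affine_poly // l_gt1.
by rewrite size_polyN -polyC_exp (leq_trans (size_polyC_leq1 _)) // ltnW.
Qed.

Lemma root_restricted_hermitian x0 a y0 b t :
  (y0 + t * b) ^+ (l + 1) = (x0 + t * a) ^+ l + (x0 + t * a) ->
  root (restricted_hermitian x0 a y0 b) t.
Proof.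
rewrite addn1 => E; rewrite /root /restricted_hermitian.
rewrite !(hornerD, hornerN, horner_exp, hornerC, hornerZ, hornerX).
by rewrite ![_ * t]mulrC E subrr.
Qed.

(** The second clause keeps [P_infty] off [r], so that every common point with the curve is
    affine. *)
Definition vertical_at r x1 y1 : Prop :=
  (forall x y z : K, hcoord x y z 1 \in (r : {vspace _}) <-> x = x1 /\ y = y1)
  /\ hcoord 1 0 0 0 \notin (r : {vspace _}).

Lemma few_points_or_vertical r :
  (#|pg3_points_on r :&: GK l K| <= l.+1)%N \/
  exists x1 y1, vertical_at r x1 y1.
Proof.
have [/existsP[x0 /existsP[y0 /existsP[z0 ru]]]|no_affine] :=
  boolP [exists x0, [exists y0, [exists z0,
    hcoord x0 y0 z0 1 \in (r : {vspace _})]]]; last first.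
  (* In the plane at infinity the curve has only [P_infty]. *)
  left; apply: (@leq_trans 1) => //; apply/card_le1_eqP => P Q.
  have at_oo R : R \in pg3_points_on r :&: GK l K -> has_coords R 1 0 0 0.
    rewrite inE => /andP[rR /mem_GK[//|[x [y [z [/(has_coords_mem rR) ru _ _]]]]]].
    case/negP: no_affine.
    by apply/existsP; exists x; apply/existsP; exists y; apply/existsP; exists z.
  by move=> /at_oo hP /at_oo hQ; exact: has_coords_uniq hQ hP.
have [a [b [c [abc0 rd r_param r_oo]]]] := affine_line_param ru.
pose u := hcoord x0 y0 z0 1; pose d := hcoord a b c 0.
have param P : P \in pg3_points_on r :&: GK l K -> has_coords P 1 0 0 0 \/
    exists2 t, pg3_point_space P == <[u + t *: d]>%VS
      & root (restricted_hermitian x0 a y0 b) t.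
  rewrite inE => /andP[rP /mem_GK[|[x [y [z [hP _ Exy]]]]]]; first by left.
  have [t [x_E y_E z_E]] := r_param _ _ _ (has_coords_mem rP hP); right.
  exists t; last by apply: root_restricted_hermitian; rewrite -x_E -y_E.
  by rewrite hcoordZ hcoordD mulr0 addr0 -x_E -y_E -z_E.
have [b0|b0] := eqVneq b 0; last first.
  left; rewrite -ltnS -(size_restricted_hermitian x0 a y0 b0).
  apply: (@card_param_lt_size _ _ (fun t => u + t *: d)).
    by rewrite -size_poly_eq0 size_restricted_hermitian.
  move=> P rP; have [hP|//] := param P rP.
  move: rP; rewrite inE => /andP[rP _].
  by have [/eqP] := r_oo (has_coords_mem rP hP); rewrite (negPf b0).
subst b; have [a0|a0] := eqVneq a 0; [subst a|]; last first.
  (* Here [P_infty] may lie on [r]: it is counted apart from the affine points, of which there are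
     at most [l]. *)
  left; pose O := [set P : pg3_point K | has_coords P 1 0 0 0].
  rewrite -(cardsID O) -[l.+1]add1n leq_add //.
    rewrite (leq_trans (subset_leq_card (subsetIr _ _))) //.
    by apply/card_le1_eqP => P Q; rewrite !inE => hP hQ;
      exact: (has_coords_uniq hQ hP).
  rewrite -ltnS -(size_restricted_hermitian0 x0 y0 a0).
  apply: (@card_param_lt_size _ _ (fun t => u + t *: d)).
    by rewrite -size_poly_eq0 size_restricted_hermitian0.
  by move=> P; rewrite !in_setD inE => /andP[/negPf hP /param[]//]; rewrite hP.
have c0 : c != 0 by move: abc0; rewrite eqxx.
right; exists x0, y0; split=> [x y z|]; last first.
  by apply: contra c0 => /r_oo[_ ->].
split=> [/r_param[t [-> -> _]]|[-> ->]]; first by rewrite !mulr0 !addr0.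
(* The direction is [(0, 0, c, 0)], so every height [z] is reached. *)
have -> : hcoord x0 y0 z 1 = u + ((z - z0) / c) *: d.
  rewrite hcoordZ hcoordD !mulr0 !addr0 divfK //; congr hcoord; ring.
by rewrite memvD ?memvZ.
Qed.

Lemma vertical_GK r x1 y1 P :
  vertical_at r x1 y1 -> P \in pg3_points_on r :&: GK l K ->
  exists z, has_coords P x1 y1 z 1 /\
    z ^+ (l ^ 2 - l + 1) = y1 ^+ (l ^ 2) - y1.
Proof.
move=> [r_aff r_oo]; rewrite inE => /andP[rP /mem_GK[/(has_coords_mem rP)|]].
  by rewrite (negPf r_oo).
move=> [x [y [z [hP zE _]]]].
by have [x_E y_E] := (r_aff x y z).1 (has_coords_mem rP hP); subst x y; exists z.
Qed.

Lemma card_vertical_leq r x1 y1 :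
  vertical_at r x1 y1 ->
  (#|pg3_points_on r :&: GK l K| <= l ^ 2 - l + 1)%N.
Proof.
move=> vr; rewrite -ltnS addn1.
rewrite -(@size_XnsubC _ _ (y1 ^+ (l ^ 2) - y1) (ltn0Sn (l ^ 2 - l))).
apply: (@card_param_lt_size _ _ (fun z => hcoord x1 y1 z 1)).
  by rewrite -size_poly_eq0 size_XnsubC.
move=> P /(vertical_GK vr)[z [hP zE]]; exists z => //.
by rewrite /root !hornerE -addn1 zE subrr.
Qed.

(** The equation for [z] becomes [z ^ (l ^ 2 - l + 1) = 0], whose only solution is 0. *)
Lemma card_vertical_rational r x1 y1 :
  vertical_at r x1 y1 -> y1 ^+ (l ^ 2) = y1 ->
  (#|pg3_points_on r :&: GK l K| <= 1)%N.
Proof.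
move=> vr y1q; apply/card_le1_eqP => P Q.
have z0 R : R \in pg3_points_on r :&: GK l K -> has_coords R x1 y1 0 1.
  move=> /(vertical_GK vr)[z [hR /eqP]].
  by rewrite y1q subrr expf_eq0 => /andP[_ /eqP <-].
by move=> /z0 hP /z0 hQ; exact: has_coords_uniq hQ hP.
Qed.

End LinesAndCurve.

(* The bound and its equality case *)
Local Close Scope ring_scope.

Theorem proposition3p1 (p h l : nat) (K : finFieldType)
    (p_prime : prime p) (h_ge1 : 1 <= h) (l_def : l = p ^ h)
    (cardK : #|K| = l ^ 6) :
  (forall r : pg3_line K,
     #|pg3_points_on r :&: GK l K| <= l ^ 2 - l + 1)
  /\
  (l <> 2 ->
   forall r : pg3_line K, secant l (l ^ 2 - l + 1) r ->
     parallel_to_z_axis r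
     /\ forall P : pg3_point K, P \in pg3_points_on r :&: GK l K ->
          P \notin GK_rational l (l ^ 2) K).
Proof.
have l_gt1 : 1 < l.
  rewrite l_def; apply: leq_trans (prime_gt1 p_prime) _.
  by rewrite -{1}(expn1 p) leq_exp2l ?prime_gt1.
split=> [r|l_neq2 r r_sec].
  have [|[x1 [y1 vr]]] := few_points_or_vertical l_gt1 r.
    by move=> /leq_trans; apply; nia.
  exact: card_vertical_leq vr.
have [|[x1 [y1 vr]]] := few_points_or_vertical l_gt1 r.
  (* For [l > 2], [l + 1] is strictly below [l ^ 2 - l + 1]; for [l = 2] both are 3, and counting
     would not exclude this case. *)
  by rewrite r_sec; nia.
split; first by exists x1, y1; case: vr.
move=> P rP; apply/negP; rewrite inE => /andP[_ P_rat].
have [z [hP _]] := vertical_GK vr rP.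
(* One rational common point makes [y1] rational, leaving at most one common point, while
   [l ^ 2 - l + 1 > 1]. *)
have := card_vertical_rational vr (rational_affine P_rat hP).
by rewrite r_sec; nia.
Qed.
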